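(* Let $p,q\ge 0$ be integers. The collection of numbers $\{A_{p,q}(i,j):\ i,j\ge 0,\ (i,j)\neq(0,0)\}$ satisfying the recurrence relation $$A_{p,q}(i,j)=(j+q+1)\,A_{p,q}(i-1,j)+(i+p+1)\,A_{p,q}(i,j-1)\qquad\text{for all } i,j>0$$ and the initial conditions $$A_{p,q}(i,0)=(q+1)^i,\qquad A_{p,q}(0,j)=(p+1)^j,\qquad i,j>0,$$ is given by the formula $$A_{p,q}(i,j)=\sum_{t=0}^{i}(-1)^{i-t}\binom{p+q+t+1}{t}\binom{p+q+i+j+2}{i-t}(p+1+t)^{i+j}.$$
   Context: Indices $i,j$ are nonnegative integers. The numbers $A_{p,q}(i,j)$ are the generalized Eulerian numbers: $A_{p,q}(i,j)$ is the number of directed paths from $(p,q)$ to $(p+i,q+j)$ in the Euler graph, the directed multigraph on $\mathbb{Z}_{\ge0}^2$ having exactly $j+1$ edges from $(i,j)$ to $(i+1,j)$, exactly $i+1$ edges from $(i,j)$ to $(i,j+1)$, and no other edges; these path counts satisfy the stated recurrence and initial conditions. The recurrence and initial conditions determine the collection uniquely. *)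

(* Defs.v *)
From HB Require Import structures.
From mathcomp Require Import all_boot all_order all_algebra finmap.
From mathcomp Require Import classical_sets cardinality.

Set Implicit Arguments.
Unset Strict Implicit.
Unset Printing Implicit Defensive.

Import GRing.Theory Num.Theory.
Local Open Scope ring_scope.

Definition vertex : Type := (nat * nat)%type.

(* Number of edges from u to v in the Euler graph. *)
Definition euler_mult (u v : vertex) : nat :=
  if v == (u.1.+1, u.2) then u.2.+1
  else if v == (u.1, u.2.+1) then u.1.+1
  else 0%N.

(* A path starting at u is the sequence of its edges; an edge leaving the
   current vertex u is encoded as (v, k), with v its target and
   k < euler_mult u v the index that tells parallel edges apart. *)
Fixpoint euler_path (u v : vertex) (s : seq (vertex * nat)) : bool :=
  if s is (w, k) :: s' then (k < euler_mult u w)%N && euler_path w v s'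
  else u == v.

(* fset_set sends infinite sets to the empty set; there are only finitely many
   paths between two given vertices, so no such junk value occurs here. *)
Definition gen_eulerian (p q i j : nat) : nat :=
  #|` fset_set [set s | euler_path (p, q) (p + i, q + j)%N s]%classic |%fset.

(* The value A 0 0 is not constrained. *)
Definition eulerian_system (p q : nat) (A : nat -> nat -> int) : Prop :=
  [/\ forall i j : nat, (0 < i)%N -> (0 < j)%N ->
        A i j = (j + q + 1)%:Z * A (i - 1)%N j + (i + p + 1)%:Z * A i (j - 1)%N,
      forall i : nat, (0 < i)%N -> A i 0%N = (q + 1)%:Z ^+ i
    & forall j : nat, (0 < j)%N -> A 0%N j = (p + 1)%:Z ^+ j].

(* Main.v *)
Require Import Defs.
From HB Require Import structures.
From mathcomp Require Import all_boot all_order all_algebra finmap.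
From mathcomp Require Import classical_sets cardinality.
From mathcomp Require Import zify ring.

(** Sorting the paths into a vertex by their last edge gives the recurrence for
    the path counts: (p + i, q + j) is entered by q + j + 1 edges from its left
    neighbour and by p + i + 1 edges from its lower neighbour. On the boundary
    of the quadrant based at (p, q) only one of the two neighbours can be
    reached, which makes the counts geometric there ([gen_eulerian_system]).

    A solution of the system is determined away from (0, 0) by induction on
    (i, j), so it remains to see that the closed formula solves the system. Put
    n = i + j and let j be any integer, that is, treat i and n as independent
    ([eulerian_sum]). With N = p + q + n + 3 and k = i + 1 - t, the recurrence
    from n to n + 1 holds separately for every t, because after Pascal's rule
    for C(N, k) it reduces to k C(N - 1, k) = (N - k) C(N - 1, k - 1)
    ([eulerian_sum_rec]).

    The formula gives (p + 1) ^ j at i = 0 by inspection. The other boundary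
    j = 0 is where the content lies. The recurrence, being valid there too,
    yields the factor q + 1 as soon as the formula vanishes on the line j = -1.
    On that line the product of the two binomials is C(i, t) times a factor
    independent of t, so the sum is an i-th finite difference of a polynomial
    of degree i - 1, which is 0 ([eulerian_sum_diag]). *)

Set Implicit Arguments.
Unset Strict Implicit.
Unset Printing Implicit Defensive.

Import GRing.Theory Num.Theory.
Local Open Scope ring_scope.

(** * Counting paths by their last edge *)

(** The paths of length n from u to v, listed by extending on the right. When a
    coordinate of v is 0, its predecessor is v itself; there is no edge from v
    to v, so that branch lists nothing. *)
Fixpoint euler_paths (u : vertex) (n : nat) (v : vertex) :
    seq (seq (vertex * nat)) :=
  if n is n'.+1 then
    let extend x := [seq rcons s (v, k) | s <- euler_paths u n' x,
                                          k <- iota 0 (euler_mult x v)] in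
    extend (v.1.-1, v.2) ++ extend (v.1, v.2.-1)
  else if u == v then [:: [::]] else [::].

Lemma euler_mult_left (a b : nat) : euler_mult (a, b) (a.+1, b) = b.+1.
Proof. by rewrite /euler_mult eqxx. Qed.

Lemma euler_mult_up (a b : nat) : euler_mult (a, b) (a, b.+1) = a.+1.
Proof.
by rewrite /euler_mult /= xpair_eqE (ltn_eqF (ltnSn a)) eqxx.
Qed.

Lemma euler_mult_id (u : vertex) : euler_mult u u = 0%N.
Proof. by rewrite /euler_mult; case: u => a b; rewrite !xpair_eqE !(ltn_eqF (ltnSn _)) andbF. Qed.

Lemma euler_mult_gt0 (u v : vertex) :
  (0 < euler_mult u v)%N -> v = (u.1.+1, u.2) \/ v = (u.1, u.2.+1).
Proof.
by rewrite /euler_mult; case: eqP => [->|_]; [left|case: eqP => // ->; right].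
Qed.

Lemma euler_path_last (u v : vertex) (s : seq (vertex * nat)) :
  euler_path u v s -> last u (unzip1 s) = v.
Proof.
by elim: s u => [|[w k] s IHs] u /=; [move/eqP | case/andP=> _ /IHs].
Qed.

Lemma euler_path_rcons (u v w : vertex) (s : seq (vertex * nat)) (k : nat) :
  euler_path u v (rcons s (w, k)) =
  let x := last u (unzip1 s) in
  [&& w == v, (k < euler_mult x w)%N & euler_path u x s].
Proof.
elim: s u => [|[x l] s IHs] u /=; first by rewrite eqxx andbT andbC.
by rewrite IHs /= andbCA [in LHS](andbCA (_ < euler_mult u _)%N).
Qed.

(** Every edge raises the coordinate sum by one, so all the paths between two
    given vertices have the same length; this is why listing the paths of a
    fixed length exhausts them. *)
Lemma euler_path_monotone (u v : vertex) (s : seq (vertex * nat)) :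
  euler_path u v s ->
  [/\ (u.1 <= v.1)%N, (u.2 <= v.2)%N & (u.1 + u.2 + size s = v.1 + v.2)%N].
Proof.
elim: s u => [|[w k] s IHs] u /=; first by move/eqP->; rewrite addn0.
case/andP=> /(leq_ltn_trans (leq0n k))/euler_mult_gt0 + /IHs[].
by case=> -> /=; split; lia.
Qed.

Lemma mem_euler_paths (u v : vertex) (n : nat) (s : seq (vertex * nat)) :
  (s \in euler_paths u n v) = (size s == n) && euler_path u v s.
Proof.
elim: n v s => [|n IHn] v s /=.
  case: (u =P v) => [->|nuv]; case: s => [|[w k] s] //=.
  - by rewrite eqxx.
  - by apply/esym/eqP.
case/lastP: s => [|s [w k]].
  by rewrite mem_cat; apply/norP; split;
     apply/negP => /allpairsPdep[s [k [_ _]]]; case: s.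
have mem_extend x : (rcons s (w, k) \in [seq rcons s (v, k)
    | s <- euler_paths u n x, k <- iota 0 (euler_mult x v)]) =
  [&& w == v, (k < euler_mult x v)%N, size s == n & euler_path u x s].
  apply/allpairsPdep/and4P => [[r [l [+ + /rcons_inj[-> -> ->]]]]|].
    by rewrite IHn mem_iota => /andP[].
  by case=> /eqP-> lt_k sz_s path_s; exists s, k; rewrite IHn sz_s path_s mem_iota.
rewrite mem_cat !mem_extend size_rcons eqSS euler_path_rcons /=.
have [->|] := eqVneq w v; last by rewrite andbF.
rewrite /=; apply/orP/and3P => [[] /and3P[lt_k -> path_s]|[-> lt_k path_s]].
- by move: lt_k; rewrite (euler_path_last path_s).
- by move: lt_k; rewrite (euler_path_last path_s).
have [def_v|def_v] := euler_mult_gt0 (leq_ltn_trans (leq0n k) lt_k).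
- left; have <- : last u (unzip1 s) = (v.1.-1, v.2).
    by rewrite def_v; case: (last _ _).
  by rewrite lt_k path_s.
- right; have <- : last u (unzip1 s) = (v.1, v.2.-1).
    by rewrite def_v; case: (last _ _).
  by rewrite lt_k path_s.
Qed.

(** The two families of extensions are disjoint because their members pass
    through different vertices just before v, except when both predecessors
    coincide, which forces v = (0, 0) and both families are empty. *)
Lemma uniq_euler_paths (u v : vertex) (n : nat) : uniq (euler_paths u n v).
Proof.
elim: n v => [|n IHn] v /=; first by case: ifP.
have uniq_extend x : uniq [seq rcons s (v, k) | s <- euler_paths u n x,
                                                k <- iota 0 (euler_mult x v)].
  apply: allpairs_uniq => //; first exact: iota_uniq.
  by move=> [s k] [s' k'] _ _ /= /rcons_inj[-> ->].
rewrite cat_uniq !uniq_extend andbT /=.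
apply/hasPn => _ /allpairsPdep[s [k [+ + ->]]]; rewrite mem_euler_paths mem_iota.
case/andP=> _ /euler_path_last last_s lt_k.
apply/negP => /allpairsPdep[s' [k' [+ _ /rcons_inj[eq_s _]]]].
rewrite -{s'}eq_s mem_euler_paths => /andP[_ /euler_path_last].
move: lt_k; rewrite last_s; case: v {uniq_extend last_s} => [[|a] [|b]] /=.
all: by rewrite ?euler_mult_id // => _ []; lia.
Qed.

(** The bridge from the cardinality of a set of paths of unspecified length to
    the length of an explicit list, on which the recurrences can be read off. *)
Lemma gen_eulerianE (p q i j : nat) :
  gen_eulerian p q i j = size (euler_paths (p, q) (i + j) (p + i, q + j)%N).
Proof.
rewrite /gen_eulerian.
set L := euler_paths _ _ _.
have -> : [set s | euler_path (p, q) (p + i, q + j)%N s]%classic =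
          [set` [fset s in L]%fset]%classic.
  apply/seteqP; split=> s /=; rewrite inE mem_euler_paths; last by case/andP.
  by move=> path_s; rewrite path_s andbT; case: (euler_path_monotone path_s) => /=; lia.
by rewrite set_fsetK card_fseq undup_id // uniq_euler_paths.
Qed.

Lemma size_euler_pathsS (u : vertex) (n a b : nat) :
  size (euler_paths u n.+1 (a, b)) =
  (euler_mult (a.-1, b) (a, b) * size (euler_paths u n (a.-1, b)) +
   euler_mult (a, b.-1) (a, b) * size (euler_paths u n (a, b.-1)))%N.
Proof. by rewrite /= size_cat !size_allpairs !size_iota !(mulnC (size _)). Qed.

Lemma euler_paths_nil (u v : vertex) (n : nat) :
  ((v.1 < u.1) || (v.2 < u.2))%N -> euler_paths u n v = [::].
Proof.
move=> lt_vu; case def_L: euler_paths => [|s L] //.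
have: s \in euler_paths u n v by rewrite def_L mem_head.
rewrite mem_euler_paths => /andP[_ /euler_path_monotone[]]; lia.
Qed.

Lemma gen_eulerian00 (p q : nat) : gen_eulerian p q 0 0 = 1%N.
Proof. by rewrite gen_eulerianE /= !addn0 eqxx. Qed.

Lemma gen_eulerianSS (p q i j : nat) :
  gen_eulerian p q i.+1 j.+1 =
  ((j.+1 + q + 1) * gen_eulerian p q i j.+1 +
   (i.+1 + p + 1) * gen_eulerian p q i.+1 j)%N.
Proof.
rewrite !gen_eulerianE addSn size_euler_pathsS !addnS !succnK.
rewrite euler_mult_left euler_mult_up !addn0 addSn.
by congr (_ * _ + _ * _)%N; lia.
Qed.

(** The predecessor below (p + i + 1, q) has second coordinate less than q and
    cannot be reached, unless q = 0, and then there is no edge from it. *)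
Lemma gen_eulerianS0 (p q i : nat) :
  gen_eulerian p q i.+1 0 = ((q + 1) * gen_eulerian p q i 0)%N.
Proof.
rewrite !gen_eulerianE addSn size_euler_pathsS !addn0 addnS succnK.
rewrite euler_mult_left addn1; case: q => [|q].
  by rewrite euler_mult_id addn0.
by rewrite [in X in (_ + X)%N]euler_paths_nil ?muln0 ?addn0 //= ltnSn orbT.
Qed.

Lemma gen_eulerian0S (p q j : nat) :
  gen_eulerian p q 0 j.+1 = ((p + 1) * gen_eulerian p q 0 j)%N.
Proof.
rewrite !gen_eulerianE !add0n size_euler_pathsS addn0 addnS succnK.
rewrite euler_mult_up addn1; case: p => [|p].
  by rewrite euler_mult_id.
by rewrite [in X in (X + _)%N]euler_paths_nil ?muln0 //= ltnSn.
Qed.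

Lemma gen_eulerian_system (p q : nat) :
  eulerian_system p q (fun i j : nat => (gen_eulerian p q i j)%:Z).
Proof.
split=> [[//|i] [//|j] _ _|i _|j _].
- by rewrite !subn1 /= gen_eulerianSS PoszD !PoszM.
- by elim: i => [|i IHi]; rewrite ?gen_eulerian00 // gen_eulerianS0 PoszM IHi exprS.
- by elim: j => [|j IHj]; rewrite ?gen_eulerian00 // gen_eulerian0S PoszM IHj exprS.
Qed.

(** * Vanishing of finite differences *)

(** The n-th finite difference kills polynomials of degree d < n. In the
    induction on d, one factor x + t of the power is split off: the part x
    leaves the same sum with d - 1, and the part t is absorbed by
    t C(n, t) = n C(n - 1, t - 1), leaving the sum for n - 1, d - 1 and x + 1. *)
Lemma alternating_binomial_sum_eq0 (R : comPzRingType) (n d : nat) (x : R) :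
  (d < n)%N ->
  \sum_(0 <= t < n.+1) (-1) ^+ t * 'C(n, t)%:R * (x + t%:R) ^+ d = 0.
Proof.
elim: d n x => [|d IHd] [//|n] x lt_dn.
  transitivity ((1 - 1 : R) ^+ n.+1); last by rewrite subrr expr0n.
  rewrite exprDn big_mkord; apply: eq_bigr => t _.
  by rewrite expr1n mul1r mulr1 mulr_natr.
have sum_S : \sum_(0 <= t < n.+2)
      (-1) ^+ t * 'C(n.+1, t)%:R * t%:R * (x + t%:R) ^+ d =
    - n.+1%:R * \sum_(0 <= t < n.+1)
      (-1) ^+ t * 'C(n, t)%:R * (x + 1 + t%:R) ^+ d.
  rewrite big_nat_recl // mulr0 mul0r add0r mulr_sumr.
  apply: eq_bigr => t _.
  rewrite -[_ * _%:R * _%:R]mulrA -natrM [('C(_, _) * _)%N]mulnC -mul_bin_diag.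
  by rewrite natrM -addrA nat1r exprS; ring.
transitivity (x * \sum_(0 <= t < n.+2)
                    (-1) ^+ t * 'C(n.+1, t)%:R * (x + t%:R) ^+ d +
              \sum_(0 <= t < n.+2)
                (-1) ^+ t * 'C(n.+1, t)%:R * t%:R * (x + t%:R) ^+ d).
  rewrite mulr_sumr -big_split; apply: eq_bigr => t _ /=.
  by rewrite exprS; ring.
by rewrite sum_S !IHd ?mulr0 ?addr0 // ltnW.
Qed.

(** * The closed formula *)

(** The closed formula with i + j replaced by an independent n, so that the
    value for j = -1 makes sense: it is the case n = i - 1. *)
Definition eulerian_sum (p q i n : nat) : int :=
  \sum_(0 <= t < i.+1)
    (-1) ^+ (i - t) * 'C(p + q + t + 1, t)%:Z * 'C(p + q + n + 2, i - t)%:Z *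
      (p + 1 + t)%:Z ^+ n.

(** Stated over the integers because the truncated subtraction in [mul_bin_left]
    does not combine with ring identities. *)
Lemma mul_bin_left_int (n k : nat) :
  k.+1%:Z * 'C(n, k.+1)%:Z = (n%:Z - k%:Z) * 'C(n, k)%:Z.
Proof.
have [lt_nk|le_kn] := ltnP n k; first by rewrite !bin_small ?mulr0 // ltnW.
by rewrite -PoszM mul_bin_left PoszM subzn.
Qed.

(** The coefficient n - i + q + 1 is j + q + 1 when n + 1 = (i + 1) + j; it may
    be negative. The identity holds summand by summand: writing x = p + 1 + t,
    the coefficients of the two sums are i + p + 2 = x + k and
    n - i + q + 1 = N - k - x for k = i + 1 - t and N = p + q + n + 3. *)
Lemma eulerian_sum_rec (p q i n : nat) :
  eulerian_sum p q i.+1 n.+1 =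
  (n%:Z - i%:Z + q%:Z + 1) * eulerian_sum p q i n +
  (i.+1 + p + 1)%:Z * eulerian_sum p q i.+1 n.
Proof.
rewrite /eulerian_sum big_nat_recr // [in X in _ + _ * X]big_nat_recr //=.
(* The top summand t = i + 1 occurs only in the two sums for i + 1. *)
rewrite !subnn !bin0 mulrDr addrA mulr_sumr mulr_sumr -big_split; congr (_ + _); last first.
  by rewrite exprS; lia.
apply: eq_big_nat => t /andP[_ lt_ti] /=.
have [k ->] : exists k, i = (t + k)%N by exists (i - t)%N; lia.
have -> : ((t + k).+1 - t = k.+1)%N by rewrite -addnS addKn.
have -> : (p + q + n.+1 + 2 = (p + q + n + 2).+1)%N by lia.
rewrite addKn binS.
have rel := mul_bin_left_int (p + q + n + 2) k.
(* After Pascal's rule, both sides differ by a multiple of rel. *)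
apply/eqP; rewrite -subr_eq0; apply/eqP.
set a := 'C(_, k.+1) in rel *; set b := 'C(_, k) in rel *.
set c := 'C(_, t).
transitivity ((-1) ^+ k * c%:Z * (p + 1 + t)%:Z ^+ n *
   (k.+1%:Z * a%:Z - ((p + q + n + 2)%:Z - k%:Z) * b%:Z)); last by rewrite rel subrr mulr0.
rewrite !exprS; set y := _ ^+ n; set z := (-1) ^+ k.
move: (a) (b) (c) y z => a' b' c' y z.
rewrite !(PoszD, intS) //; ring.
Qed.

(** Both sides are the multinomial coefficient (m + a + b)! / (m! a! b!). *)
Lemma bin_mul_multinomial (m a b : nat) :
  ('C(m + a, a) * 'C(m + a + b, b) = 'C(m + a + b, a + b) * 'C(a + b, a))%N.
Proof.
have fact_m : (0 < a`! * b`! * m`! * (m + a)`! * (a + b)`!)%N.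
  by rewrite !muln_gt0 !fact_gt0.
have e1 := bin_fact (leq_addl m a).
have e2 := bin_fact (leq_addl (m + a) b).
have e3 := bin_fact (leq_addl m (a + b)).
have e4 := bin_fact (leq_addr b a).
rewrite !addnK addnA addKn in e1 e2 e3 e4.
apply/eqP; rewrite -(eqn_pmul2r fact_m); apply/eqP.
transitivity ('C(m + a, a) * (a`! * m`!) *
              ('C(m + a + b, b) * (b`! * (m + a)`!)) * (a + b)`!)%N; first by ring.
transitivity ('C(m + a + b, a + b) * ((a + b)`! * m`!) *
              ('C(a + b, a) * (a`! * b`!)) * (m + a)`!)%N; last by ring.
by rewrite e1 e2 e3 e4; ring.
Qed.

(** On this diagonal the product of binomials is C(p + q + i + 2, i + 1) times
    C(i + 1, t), which turns the sum into a finite difference of order i + 1 of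
    x ^ i. *)
Lemma eulerian_sum_diag (p q i : nat) : eulerian_sum p q i.+1 i = 0.
Proof.
transitivity ((-1) ^+ i.+1 * 'C(p + q + i + 2, i.+1)%:Z *
  \sum_(0 <= t < i.+2) (-1) ^+ t * 'C(i.+1, t)%:R * ((p + 1)%:Z + t%:R) ^+ i).
  rewrite mulr_sumr; apply: eq_big_nat => t /andP[_ lt_ti].
  have [k def_i] : exists k, i.+1 = (t + k)%N by exists (i.+1 - t)%N; lia.
  have -> : (p + q + i + 2 = p + q + 1 + t + k)%N by lia.
  rewrite def_i addKn addnAC.
  have /(congr1 Posz) := bin_mul_multinomial (p + q + 1) t k.
  rewrite !PoszM => bin_swap.
  rewrite -[_ * _ * 'C(_, k)%:Z]mulrA bin_swap !natz.
  have -> : (-1) ^+ k = (-1) ^+ (t + k) * (-1) ^+ t :> int.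
    by rewrite exprD mulrAC -expr2 sqrr_sign mul1r.
  rewrite -[(p + 1 + t)%:Z]/((p + 1)%:Z + t%:Z).
  by move: ('C(_, _)) ('C(t + k, t)) ((-1) ^+ _) ((-1) ^+ t) => *; ring.
by rewrite alternating_binomial_sum_eq0 ?mulr0.
Qed.

Lemma eulerian_sum0 (p q n : nat) : eulerian_sum p q 0 n = (p + 1)%:Z ^+ n.
Proof. by rewrite /eulerian_sum big_nat1 !bin0 !mul1r addn0. Qed.

Lemma eulerian_sum_system (p q : nat) :
  eulerian_system p q (fun i j => eulerian_sum p q i (i + j)).
Proof.
split=> [[//|i] [//|j] _ _|i _|j _]; last exact: eulerian_sum0.
  rewrite !subn1 /= addSn eulerian_sum_rec !addnS addSn.
  by congr (_ * _ + _ * _); lia.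
rewrite addn0; elim: i => [|i IHi]; first exact: eulerian_sum0.
by rewrite eulerian_sum_rec eulerian_sum_diag mulr0 addr0 subrr add0r IHi exprS PoszD.
Qed.

(** The recurrence never refers to the index (0, 0): it is applied only at
    i, j > 0, whose predecessors have a positive coordinate. *)
Lemma eulerian_system_unique (p q : nat) (A B : nat -> nat -> int) :
  eulerian_system p q A -> eulerian_system p q B ->
  forall i j : nat, (i, j) <> (0%N, 0%N) -> A i j = B i j.
Proof.
move=> [Arec Ai0 A0j] [Brec Bi0 B0j].
elim=> [|i IHi] [|j] ne0; first by case: ne0.
- by rewrite A0j ?B0j.
- by rewrite Ai0 ?Bi0.
elim: j {ne0} => [|j IHj]; rewrite Arec // Brec // !subn1 !succnK IHi //.
  by rewrite Ai0 ?Bi0.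
by rewrite IHj.
Qed.

Theorem theorem3p1 (p q : nat) :
  eulerian_system p q (fun i j : nat => (gen_eulerian p q i j)%:Z) /\
  forall A : nat -> nat -> int, eulerian_system p q A ->
    forall i j : nat, (i, j) <> (0%N, 0%N) ->
      A i j =
        \sum_(0 <= t < i.+1)
          (-1) ^+ (i - t)%N * ('C(p + q + t + 1, t))%:Z
            * ('C(p + q + i + j + 2, i - t))%:Z * (p + 1 + t)%:Z ^+ (i + j)%N.
Proof.
split=> [|A sysA i j ne0]; first exact: gen_eulerian_system.
rewrite (eulerian_system_unique sysA (eulerian_sum_system p q) ne0).
by rewrite /eulerian_sum !addnA.
Qed.
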